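(* Let $N\in\mathbb{N}$, $0<\beta<1/(N+1)$ and $m\in\mathbb{N}$. A vector $\boldsymbol{t}=(t_0,t_1,\ldots,t_m)\in T^{m+1}$ with $0=t_0<t_1<\cdots<t_m$ is an admissible translation vector if and only if the directed graph $G_{\boldsymbol{t}}=(V_{\boldsymbol{t}},E_{\boldsymbol{t}})$ contains no cycles.
   Context: $\mathbb{N}=\{1,2,\ldots\}$. Let $\phi_i(x)=\beta x+i\frac{1-\beta}{N}$ for $i=0,1,\ldots,N$, and let $\Gamma\subset\mathbb{R}$ be the attractor of this IFS, i.e. the unique non-empty compact set with $\Gamma=\bigcup_{i=0}^N\phi_i(\Gamma)$. For $\boldsymbol{t}=(t_0,\ldots,t_m)$ let $\Gamma_{\boldsymbol{t}}=\bigcup_{j=0}^m(\Gamma+t_j)$. Let $\Omega=\{0,1,\ldots,N\}$. For a word $\mathbf{i}=i_1\ldots i_n\in\Omega^n$ put $\phi_{\mathbf{i}}=\phi_{i_1}\circ\cdots\circ\phi_{i_n}$. For $n\in\mathbb{N}$ let $E_n=\{\phi_{\mathbf{i}}(0):\mathbf{i}\in\Omega^n\}$, $T_n=\beta^{-n}E_n$ (an increasing sequence of sets), $T=\bigcup_{n=1}^\infty T_n$. For $\boldsymbol{t}\in T^{m+1}$ with $0=t_0<t_1<\cdots<t_m$, let $\tau_{\boldsymbol{t}}\in\mathbb{N}$ be the smallest integer such that $t_1,\ldots,t_m\in T_{\tau_{\boldsymbol{t}}}$, and for $n\ge\tau_{\boldsymbol{t}}$ let $$\Omega_{\boldsymbol{t}}^n=\{\mathbf{i}\in\Omega^n:\phi_{\mathbf{i}}(t_j)\in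 E_n\ \forall 1\le j\le m\},\qquad \widehat{\Omega}_{\boldsymbol{t}}^n=\{\mathbf{i}\in\Omega^n:\phi_{\mathbf{i}}(-t_j)\in E_n\ \forall 1\le j\le m\}.$$ Admissible: a vector $\boldsymbol{t}\in\mathbb{R}^{m+1}$ with $0=t_0<t_1<\cdots<t_m$ is an admissible translation vector if $\boldsymbol{t}\in T^{m+1}$ and there exist two finite sets $\mathcal{I}_1\subset\bigcup_{n=\tau_{\boldsymbol{t}}}^\infty\Omega_{\boldsymbol{t}}^n$ and $\mathcal{I}_2\subset\bigcup_{n=\tau_{\boldsymbol{t}}}^\infty\widehat{\Omega}_{\boldsymbol{t}}^n$ such that $\bigcup_{\mathbf{i}\in\mathcal{I}_1}\phi_{\mathbf{i}}(\Gamma_{\boldsymbol{t}})\cup\bigcup_{\mathbf{i}\in\mathcal{I}_2}\phi_{\mathbf{i}}(1-\Gamma_{\boldsymbol{t}})=\Gamma$, where $1-A=\{1-x:x\in A\}$. The function $\vartheta$: let $\mathcal{B}_N$ be the set of $0<\beta<1/(N+1)$ such that for any $n\in\mathbb{N}$, any $i_1,\ldots,i_n\in\{0,1,\ldots,2N\}$ and any $j_1,\ldots,j_n\in\{0,1,\ldots,N\}$, the equality $\sum_{k=1}^n i_k\beta^k=\sum_{k=1}^n j_k\beta^k$ implies $i_k=j_k$ for all $1\le k\le n$. For $n\in\mathbb{N}$ let $\beta_n$ be the unique root in $(0,1/(N+1))$ of $N\sum_{k=1}^n x^k+2N\sum_{k=n+1}^\infty x^k=1$, i.e. of $(N+1)x+Nx^{n+1}=1$;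 the sequence $\beta_n$ increases to $1/(N+1)$. Put $\vartheta(\beta)=0$ if $\beta\in\mathcal{B}_N$, and $\vartheta(\beta)=\min\{n\in\mathbb{N}:\beta\le\beta_n\}$ otherwise. The graph: for $n\ge\tau_{\boldsymbol{t}}$ let $\mathcal{A}_{\boldsymbol{t}}^n,\widehat{\mathcal{A}}_{\boldsymbol{t}}^n\subset\Omega^n$ be the subsets with $$\{\phi_{\mathbf{j}}(0):\mathbf{j}\in\mathcal{A}_{\boldsymbol{t}}^n\}=\{\phi_{\mathbf{i}}(t_j):\mathbf{i}\in\Omega_{\boldsymbol{t}}^n,\,0\le j\le m\},\qquad \{\phi_{\mathbf{j}}(0):\mathbf{j}\in\widehat{\mathcal{A}}_{\boldsymbol{t}}^n\}=\{\phi_{\mathbf{i}}(-t_j):\mathbf{i}\in\widehat\Omega_{\boldsymbol{t}}^n,\,0\le j\le m\}$$ (they are unique since $\mathbf{j}\mapsto\phi_{\mathbf{j}}(0)$ is injective on $\Omega^n$), and let $\mathcal{W}_{\boldsymbol{t}}^n=\mathcal{A}_{\boldsymbol{t}}^n\cup\widehat{\mathcal{A}}_{\boldsymbol{t}}^n$. With $n_0=\tau_{\boldsymbol{t}}+\vartheta(\beta)$, the directed graph $G_{\boldsymbol{t}}=(V_{\boldsymbol{t}},E_{\boldsymbol{t}})$ has vertex set $V_{\boldsymbol{t}}=\Omega^{n_0}\setminus\mathcal{W}_{\boldsymbol{t}}^{n_0}$, and for $\mathbf{i}=i_1\ldots i_{n_0},\ \mathbf{j}=j_1\ldots j_{n_0}\in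 V_{\boldsymbol{t}}$ there is an edge from $\mathbf{i}$ to $\mathbf{j}$ if and only if $i_2i_3\ldots i_{n_0}=j_1j_2\ldots j_{n_0-1}$ (this may be a loop; if $n_0=1$ the condition is vacuous). A directed graph contains a cycle if there is a directed path (with at least one edge) starting and ending at the same vertex; the empty graph contains no cycles. *)

(* Defs.v *)
From mathcomp Require Import all_boot all_order all_algebra.
From mathcomp Require Import all_classical all_reals all_analysis.
Import Order.TTheory GRing.Theory Num.Theory numFieldNormedType.Exports.

Set Implicit Arguments.
Unset Strict Implicit.
Unset Printing Implicit Defensive.

Local Open Scope classical_set_scope.
Local Open Scope ring_scope.

(* Junk value 0 if P is empty. *)
Definition least (P : set nat) : nat :=
  xget 0%N [set n | P n /\ forall k, P k -> (n <= k)%N].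

(* The alphabet {0, ..., N} is 'I_N.+1; words of arbitrary length are
   sequences, so that sets mixing words of different lengths can be formed. *)
Notation word N := (seq 'I_N.+1).

Definition phi (R : realType) (N : nat) (beta : R) (i : 'I_N.+1) (x : R) : R :=
  beta * x + (i : nat)%:R * ((1 - beta) / N%:R).

Definition phiw (R : realType) (N : nat) (beta : R) (w : word N) (x : R) : R :=
  foldr (phi beta) x w.

Definition is_attractor (R : realType) (N : nat) (beta : R) (Gamma : set R) :=
  [/\ Gamma !=set0, compact Gamma &
      Gamma = \bigcup_(i in [set: 'I_N.+1]) (phi beta i @` Gamma)].

Definition words (N n : nat) : set (word N) := [set w | size w = n].

Definition E_ (R : realType) (N : nat) (beta : R) (n : nat) : set R :=
  [set phiw beta w 0 | w in @words N n].

Definition T_ (R : realType) (N : nat) (beta : R) (n : nat) : set R :=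
  [set beta ^- n * x | x in E_ N beta n].

Definition T (R : realType) (N : nat) (beta : R) : set R :=
  \bigcup_(n in [set n : nat | (0 < n)%N]) T_ N beta n.

Definition increasing_from0 (R : realType) (m : nat) (t : 'I_m.+1 -> R) :=
  t ord0 = 0 /\ forall i j : 'I_m.+1, (i < j)%N -> t i < t j.

Definition Gamma_t (R : realType) (m : nat) (Gamma : set R)
    (t : 'I_m.+1 -> R) : set R :=
  \bigcup_(j in [set: 'I_m.+1]) [set x + t j | x in Gamma].

Definition tau (R : realType) (N : nat) (beta : R) (m : nat)
    (t : 'I_m.+1 -> R) : nat :=
  least [set n | (0 < n)%N /\
                 forall j : 'I_m.+1, (0 < j)%N -> T_ N beta n (t j)].

Definition Omega_t (R : realType) (N : nat) (beta : R) (m : nat)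
    (t : 'I_m.+1 -> R) (n : nat) : set (word N) :=
  [set w | words n w /\
     forall j : 'I_m.+1, (0 < j)%N -> E_ N beta n (phiw beta w (t j))].

Definition Omegahat_t (R : realType) (N : nat) (beta : R) (m : nat)
    (t : 'I_m.+1 -> R) (n : nat) : set (word N) :=
  [set w | words n w /\
     forall j : 'I_m.+1, (0 < j)%N -> E_ N beta n (phiw beta w (- t j))].

Definition admissible (R : realType) (N : nat) (beta : R) (Gamma : set R)
    (m : nat) (t : 'I_m.+1 -> R) : Prop :=
  [/\ increasing_from0 t, forall j, T N beta (t j) &
  exists I1 I2 : set (word N),
  [/\ finite_set I1, finite_set I2,
      I1 `<=` \bigcup_(n in [set n | (tau N beta t <= n)%N]) Omega_t beta t n,
      I2 `<=` \bigcup_(n in [set n | (tau N beta t <= n)%N])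
                Omegahat_t beta t n &
      \bigcup_(w in I1) (phiw beta w @` Gamma_t Gamma t) `|`
      \bigcup_(w in I2) (phiw beta w @` [set 1 - x | x in Gamma_t Gamma t])
      = Gamma]].

Definition B_set (R : realType) (N : nat) : set R :=
  [set beta | 0 < beta < 1 / N.+1%:R /\
    forall (n : nat) (i : 'I_n -> 'I_(2 * N).+1) (j : 'I_n -> 'I_N.+1),
      (0 < n)%N ->
      \sum_(k < n) (i k : nat)%:R * beta ^+ k.+1 =
      \sum_(k < n) (j k : nat)%:R * beta ^+ k.+1 ->
      forall k : 'I_n, i k = j k :> nat].

(* The root in (0, 1/(N+1)) is unique when N and n are positive. *)
Definition beta_ (R : realType) (N n : nat) : R :=
  xget 0 [set x : R | 0 < x < 1 / N.+1%:R /\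
    N%:R * (\sum_(1 <= k < n.+1) x ^+ k)
    + (2 * N)%:R * limn (fun M => \sum_(n.+1 <= k < M) x ^+ k) = 1].

Definition vartheta (R : realType) (N : nat) (beta : R) : nat :=
  if `[< B_set N beta >] then 0%N
  else least [set n | (0 < n)%N /\ beta <= beta_ R N n].

(* The words of length n coding the points of Z. For Z included in E_n this is
   the subset A of Omega^n with {phi_j(0) : j in A} = Z (codes_image); it is
   the only one when j |-> phi_j(0) is injective on Omega^n (codes_unique). *)
Definition codes (R : realType) (N : nat) (beta : R) (n : nat) (Z : set R) :
    set (word N) :=
  [set w | words n w /\ Z (phiw beta w 0)].

Lemma codes_image (R : realType) (N : nat) (beta : R) (n : nat) (Z : set R) :
  Z `<=` E_ N beta n -> [set phiw beta (w : word N) 0 | w in codes beta n Z] = Z.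
Proof.
move=> ZE; apply/seteqP; split => [_ [w [_ Zw] <-]//|z Zz].
by have [w nw wz] := ZE z Zz; exists w => //; split => //=; rewrite wz.
Qed.

Lemma codes_unique (R : realType) (N : nat) (beta : R) (n : nat) (Z : set R)
    (A : set (word N)) :
  {in words n &, injective (fun w : word N => phiw beta w 0)} ->
  A `<=` words n -> [set phiw beta (w : word N) 0 | w in A] = Z -> A = codes beta n Z.
Proof.
move=> inj An AZ; apply/seteqP; split => [w Aw|w [nw]].
  by split; [exact: An | rewrite -AZ; exists w].
rewrite -AZ => -[v Av vw]; suff <- : v = w by [].
by apply: inj => //; rewrite inE //; exact: An.
Qed.

Definition A_t (R : realType) (N : nat) (beta : R) (m : nat)
    (t : 'I_m.+1 -> R) (n : nat) : set (word N) :=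
  codes beta n (\bigcup_(w in @Omega_t R N beta m t n)
                  [set phiw beta w (t j) | j in [set: 'I_m.+1]]).

Definition Ahat_t (R : realType) (N : nat) (beta : R) (m : nat)
    (t : 'I_m.+1 -> R) (n : nat) : set (word N) :=
  codes beta n (\bigcup_(w in @Omegahat_t R N beta m t n)
                  [set phiw beta w (- t j) | j in [set: 'I_m.+1]]).

Definition W_t (R : realType) (N : nat) (beta : R) (m : nat)
    (t : 'I_m.+1 -> R) (n : nat) : set (word N) :=
  A_t beta t n `|` Ahat_t beta t n.

Lemma A_t_image (R : realType) (N : nat) (beta : R) (m : nat)
    (t : 'I_m.+1 -> R) (n : nat) : t ord0 = 0 ->
  [set phiw beta (w : word N) 0 | w in @A_t R N beta m t n] =
  \bigcup_(w in @Omega_t R N beta m t n)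
     [set phiw beta w (t j) | j in [set: 'I_m.+1]].
Proof.
move=> t0; apply: codes_image => _ [w [nw Ew] [j _ <-]].
have [/Ew//|] := ltnP 0 j; rewrite leqn0 => /eqP j0.
by rewrite (_ : j = ord0) ?t0; [exists w | exact: val_inj].
Qed.

Lemma Ahat_t_image (R : realType) (N : nat) (beta : R) (m : nat)
    (t : 'I_m.+1 -> R) (n : nat) : t ord0 = 0 ->
  [set phiw beta (w : word N) 0 | w in @Ahat_t R N beta m t n] =
  \bigcup_(w in @Omegahat_t R N beta m t n)
     [set phiw beta w (- t j) | j in [set: 'I_m.+1]].
Proof.
move=> t0; apply: codes_image => _ [w [nw Ew] [j _ <-]].
have [/Ew//|] := ltnP 0 j; rewrite leqn0 => /eqP j0.
by rewrite (_ : j = ord0) ?t0 ?oppr0; [exists w | exact: val_inj].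
Qed.

Record digraph (U : Type) := Digraph { vertices : set U ; edge : rel U }.

Definition has_cycle (U : eqType) (G : digraph U) : Prop :=
  exists (x : U) (p : seq U),
    [/\ p != [::], forall y, y \in x :: p -> vertices G y,
        path (edge G) x p & last x p = x].

Definition graph_t (R : realType) (N : nat) (beta : R) (m : nat)
    (t : 'I_m.+1 -> R) : digraph (word N) :=
  let n0 := (tau N beta t + vartheta N beta)%N in
  Digraph (words n0 `\` W_t beta t n0)
          (fun u v => behead u == take n0.-1 v).

(* Main.v *)
Require Import Defs.
From mathcomp Require Import all_boot all_order all_algebra.
From mathcomp Require Import all_classical all_reals all_analysis.
From mathcomp Require Import ring lra zify.
Import Order.TTheory GRing.Theory Num.Theory numFieldNormedType.Exports.
Local Open Scope classical_set_scope.
Local Open Scope ring_scope.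

Set Implicit Arguments.
Unset Strict Implicit.
Unset Printing Implicit Defensive.

(** Write [[v]] for the cylinder [phiw beta v @` Gamma].  Because
    [beta < 1 / (N + 1)] the first-level pieces of [[0, 1]] are disjoint, so two
    cylinders meet only if one word is a prefix of the other
    ([overlapping_cylinders_nested]); and [Gamma = 1 - Gamma]
    ([attractor_sym]).  If [w] is in [Omega_t] at level [n], then
    [phiw w (x + t j) = phiw v x], where [v] is the word of length [n] that
    codes the point [phiw w (t j)] ([Omega_t_cylinder]); hence [phiw w @` Gamma_t] is
    a union of cylinders [[v]] with [v] in [A_t], and by symmetry the reflected
    copies are unions of cylinders over [Ahat_t].  So [t] is admissible iff
    finitely many cylinders over words of [W_t], at levels at least [tau],
    cover [Gamma].

    Everything then rests on how [W_t] depends on the level.  Adding letters in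
    front keeps a word in [W_t] ([W_t_cat]).  Conversely, from level
    [n0 = tau + vartheta] on, membership depends on the last [n0] letters only
    ([W_t_drop]).  The point is a carry-free addition: an equation
    [phiw w (t j) = phiw v 0] adds to the digits of [w] the digits of [t j],
    which sit in the last [tau] places, and yields the digits of [v].  If
    [beta] is in [B_set], an expansion with digits up to [2 N] can only equal
    one with digits up to [N] digit by digit, so no carry can occur.  Otherwise [beta <= beta_ vartheta] is the inequality
    [(N + 1) beta + N beta ^ (vartheta + 1) <= 1], which says that digits added
    [vartheta + 1] or more places after the first letter are too small to change
    it.  In both cases [w] and [v] start with the same letter, which can be
    cancelled ([head_cancel]).

    If the graph is acyclic, then by the pigeonhole principle every word of
    length [n0 + (N + 1) ^ n0] has a window of length [n0] in [W_t]
    ([cycle_of_windows]); the prefix ending with this window is in [W_t] as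
    well, so the cylinders over words of bounded length in [W_t] cover
    [Gamma].  If the graph has a cycle, running around it produces words [s] of
    arbitrary length all of whose windows of length [n0] avoid [W_t].  Then no
    prefix [v] of [u := drop n0 s] is in [W_t]: otherwise [take n0 s ++ v] would
    be too, and so would its last [n0] letters, a window of [s].  By the
    separation of cylinders the points of [[u]] are left uncovered once [u] is
    longer than all the words of the two finite families. *)

(** * The maps of the iterated function system *)

Lemma leastP (P : set nat) : (exists n, P n) -> P (least P).
Proof.
move=> exP; have exb : exists n, `[< P n >].
  by case: exP => n /asboolP; exists n.
suff : [set n | P n /\ forall k, P k -> (n <= k)%N] (least P) by case.
apply: xgetPex; case: (ex_minnP exb) => n /asboolP Pn minn.
by exists n; split => // k /asboolP; exact: minn.
Qed.

Lemma phiwD (R : realType) (N : nat) (beta : R) (w : word N) (x y : R) :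
  phiw beta w (x + y) = phiw beta w x + beta ^+ size w * y.
Proof.
elim: w => [|i w IH] /=; first by rewrite mul1r.
by rewrite /phi IH exprS; ring.
Qed.

Lemma phiwE (R : realType) (N : nat) (beta : R) (w : word N) (x : R) :
  phiw beta w x = phiw beta w 0 + beta ^+ size w * x.
Proof. by rewrite -phiwD add0r. Qed.

Lemma phiw_zeros (R : realType) (N k : nat) (beta x : R) :
  phiw beta (nseq k (@ord0 N)) x = beta ^+ k * x.
Proof.
elim: k => [|k IH] /=; first by rewrite mul1r.
by rewrite IH /phi /= mul0r addr0 exprS mulrA.
Qed.

Lemma beta_lt_gap (R : realType) (N : nat) (beta : R) :
  (0 < N)%N -> beta < 1 / N.+1%:R -> beta < (1 - beta) / N%:R.
Proof.
move=> N0; rewrite ltr_pdivlMr ?ltr0Sn// ltr_pdivlMr ?ltr0n// -natr1 => h.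
by lra.
Qed.

Lemma phi_itv (R : realType) (N : nat) (beta : R) (i : 'I_N.+1) (x : R) :
  (0 < N)%N -> 0 <= beta <= 1 -> 0 <= x <= 1 -> 0 <= phi beta i x <= 1.
Proof.
move=> N0 /andP[b0 b1] /andP[x0 x1]; rewrite /phi.
have N0' : 0 < N%:R :> R by rewrite ltr0n.
have g0 : 0 <= (1 - beta) / N%:R by rewrite divr_ge0 ?subr_ge0// ltW.
rewrite (addr_ge0 (mulr_ge0 b0 x0) (mulr_ge0 (ler0n _ _) g0)) /=.
have e1 : beta * 1 + N%:R * ((1 - beta) / N%:R) = 1.
  by field; exact: lt0r_neq0.
by rewrite -[leRHS]e1 lerD ?ler_wpM2l// ler_wpM2r// ler_nat -ltnS.
Qed.

Lemma phiw_itv (R : realType) (N : nat) (beta : R) (w : word N) (x : R) :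
  (0 < N)%N -> 0 <= beta <= 1 -> 0 <= x <= 1 -> 0 <= phiw beta w x <= 1.
Proof. by move=> N0 b01 x01; elim: w => //= i w; exact: phi_itv. Qed.

Lemma lt_invSn_lt1 (R : realType) (N : nat) (beta : R) :
  beta < 1 / N.+1%:R -> beta < 1.
Proof.
by move=> /lt_le_trans; apply; rewrite ler_pdivrMr ?ltr0Sn// mul1r ler1n.
Qed.

Lemma ratio_itv (R : realType) (N : nat) (beta : R) :
  0 < beta < 1 / N.+1%:R -> 0 <= beta <= 1.
Proof. by move=> /andP[/ltW-> /lt_invSn_lt1/ltW]. Qed.

(** If the [beta]-multiples of [x] and [y] lie between 0 and the distance of
    consecutive left endpoints, neither point can reach the next first-level
    piece, so the first letter can be read off. *)
Lemma phi_separated (R : realType) (N : nat) (beta : R) (i k : 'I_N.+1)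
    (x y : R) :
  0 <= x -> 0 <= y ->
  beta * x < (1 - beta) / N%:R -> beta * y < (1 - beta) / N%:R -> 0 < beta ->
  phi beta i x = phi beta k y -> i = k /\ x = y.
Proof.
move=> x0 y0 xg yg b0 e.
suff ik : i = k.
  split => //; move: e; rewrite ik /phi => /addIr/mulfI; apply.
  exact: lt0r_neq0.
move: e; rewrite /phi; set g := (1 - beta) / N%:R => e.
have bx0 : 0 <= beta * x by rewrite mulr_ge0// ltW.
have by0 : 0 <= beta * y by rewrite mulr_ge0// ltW.
have g0 : 0 < g by exact: le_lt_trans bx0 xg.
have far (a b : 'I_N.+1) : (a < b)%N -> a%:R * g + g <= b%:R * g.
  move=> ab; rewrite -[X in _ + X]mul1r -mulrDl ler_pM2r// natr1.
  by rewrite ler_nat.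
rewrite -/g in xg yg.
by apply/val_inj/eqP; case: ltngtP => // /far; clear -e xg yg bx0 by0; lra.
Qed.

Lemma overlapping_cylinders_nested (R : realType) (N : nat) (beta : R)
    (u v : word N) (x y : R) :
  (0 < N)%N -> 0 < beta < 1 / N.+1%:R -> (size v <= size u)%N ->
  0 <= x <= 1 -> 0 <= y <= 1 -> phiw beta u x = phiw beta v y ->
  v = take (size v) u.
Proof.
move=> N0 bnd + x01 y01; have b01 := ratio_itv bnd; case/andP: bnd => b0 b1.
have bg := beta_lt_gap N0 b1.
elim: u v => [|i u IH] [|k v] //=; rewrite ltnS => sz e.
have /andP[u0 u1] := phiw_itv u N0 b01 x01.
have /andP[v0 v1] := phiw_itv v N0 b01 y01.
have lt1 z : z <= 1 -> beta * z < (1 - beta) / N%:R.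
  by move=> z1; apply: le_lt_trans bg; rewrite ger_pMr.
have [-> e'] := phi_separated u0 v0 (lt1 _ u1) (lt1 _ v1) b0 e.
by rewrite -(IH v).
Qed.

(** * The attractor *)

Lemma attractor_phi (R : realType) (N : nat) (beta : R) (Gamma : set R)
    (i : 'I_N.+1) (x : R) :
  is_attractor N beta Gamma -> Gamma x -> Gamma (phi beta i x).
Proof. by move=> [_ _ e] Gx; rewrite e; exists i => //; exists x. Qed.

Lemma attractor_phiw (R : realType) (N : nat) (beta : R) (Gamma : set R)
    (w : word N) (x : R) :
  is_attractor N beta Gamma -> Gamma x -> Gamma (phiw beta w x).
Proof. by move=> GP Gx; elim: w => //= i w; exact: attractor_phi. Qed.

Lemma attractor_code (R : realType) (N : nat) (beta : R) (Gamma : set R)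
    (n : nat) (x : R) :
  is_attractor N beta Gamma -> Gamma x ->
  exists2 u : word N, size u = n & exists2 y, Gamma y & x = phiw beta u y.
Proof.
move=> [_ _ e]; elim: n x => [|n IH] x Gx; first by exists [::] => //; exists x.
move: Gx; rewrite {1}e => -[i _ [z /IH[u su [y Gy ->]] <-]].
by exists (i :: u); [rewrite /= su | exists y].
Qed.

(** Along a coding word of length [n] of a point of [Gamma], any point of [A]
    is moved to within a multiple of [beta ^ n] of that point.  With [A] the
    unit interval this locates the attractor; with [A] its mirror image it gives the
    symmetry. *)
Lemma attractor_sub_closed_invariant (R : realType) (N : nat) (beta : R)
    (Gamma A : set R) :
  0 <= beta < 1 -> is_attractor N beta Gamma ->
  closed A -> A !=set0 -> (forall (i : 'I_N.+1) x, A x -> A (phi beta i x)) ->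
  Gamma `<=` A.
Proof.
move=> /andP[b0 b1] GP cA [a Aa] Aphi x Gx.
have [C C0 GC] : exists2 C, 0 < C & forall y, Gamma y -> `|a - y| <= C.
  have [_ /compact_bounded[M [_ GM]] _] := GP; move: GM => /(_ (`|M| + 1)).
  rewrite (le_lt_trans (ler_norm M)) ?ltrDl// => /(_ erefl) GM.
  exists (`|a| + (`|M| + 1)); first by rewrite ltr_wpDl// ltr_wpDl.
  by move=> y /GM ?; rewrite (le_trans (ler_normB _ _))// lerD2l.
apply: cA => B /nbhs_ballP[e /= e0 xB].
have [n ne] : exists n, beta ^+ n * C < e.
  have : (fun n => beta ^+ n : R) @ \oo --> (0 : R).
    by apply: cvg_expr; rewrite ger0_norm.
  move=> /cvgr0_norm_lt/(_ (e / C) (divr_gt0 e0 C0))[n _ /(_ n (leqnn n))] /=.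
  by rewrite ger0_norm ?exprn_ge0// ltr_pdivlMr// => ?; exists n.
have [u su [y Gy xE]] := attractor_code n GP Gx.
exists (phiw beta u a); split; first by elim: (u) => //= i w; exact: Aphi.
apply: xB; rewrite /ball/= xE (phiwE beta u y) (phiwE beta u a) su opprD.
rewrite addrACA subrr add0r -mulrBr normrM ger0_norm ?exprn_ge0// distrC.
by apply: le_lt_trans ne; rewrite ler_wpM2l ?exprn_ge0// GC.
Qed.

Lemma attractor_itv (R : realType) (N : nat) (beta : R) (Gamma : set R) :
  (0 < N)%N -> 0 <= beta < 1 -> is_attractor N beta Gamma ->
  forall x, Gamma x -> 0 <= x <= 1.
Proof.
move=> N0 b01 GP x Gx.
have : Gamma `<=` `[0, 1]%classic.
  apply: (attractor_sub_closed_invariant b01 GP); first exact: interval_closed.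
    by exists 0; rewrite /= in_itv /= lexx ler01.
  move=> i y; rewrite /= !in_itv /=; apply: phi_itv => //.
  by case/andP: b01 => -> /ltW ->.
by move=> /(_ _ Gx); rewrite /= in_itv.
Qed.

(** The reflection [x |-> 1 - x] conjugates the map of letter [i] into that of
    letter [N - i], so the mirror image of the attractor is closed and
    invariant too. *)
Lemma attractor_sym (R : realType) (N : nat) (beta : R) (Gamma : set R) :
  (0 < N)%N -> 0 <= beta < 1 -> is_attractor N beta Gamma ->
  forall x, Gamma x -> Gamma (1 - x).
Proof.
move=> N0 b01 GP x Gx; have [[a Ga] cG _] := GP.
have : Gamma `<=` [set 1 - y | y in Gamma].
  apply: (attractor_sub_closed_invariant b01 GP).
  - apply: compact_closed; first exact: Rhausdorff.
    apply: continuous_compact cG; apply: continuous_subspaceT => y.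
    by apply: cvgB; [exact: cvg_cst | exact: cvg_id].
  - by exists (1 - a), a.
  - move=> i _ [y Gy <-]; exists (phi beta (rev_ord i) y).
      exact: attractor_phi.
    rewrite /phi /= subSS natrB -1?ltnS//; field.
    by rewrite pnatr_eq0 -lt0n.
by move=> /(_ _ Gx)[y Gy <-]; rewrite opprB addrC subrK.
Qed.

(** * The exponent vartheta *)

Lemma limn_geometric_tail (R : realType) (n : nat) (x : R) :
  0 < x < 1 ->
  limn (fun M => \sum_(n <= k < M) x ^+ k) = x ^+ n / (1 - x).
Proof.
move=> /andP[x0 x1]; apply/cvg_lim => //.
have x1' : 1 - x != 0 by rewrite subr_eq0 gt_eqF.
have : (fun M => x ^+ n / (1 - x) - x ^+ M / (1 - x)) @ \oo -->
    x ^+ n / (1 - x) - 0 / (1 - x).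
  apply: cvgB; first exact: cvg_cst.
  by apply: cvgMl; apply: cvg_expr; rewrite ger0_norm ?ltW.
rewrite mul0r subr0; apply: cvg_trans; apply: near_eq_cvg.
exists n => // M /= nM; elim: M nM => [|M IH] nM.
  by move: nM; rewrite leqn0 => /eqP ->; rewrite big_geq// subrr.
move: nM; rewrite leq_eqVlt => /orP[/eqP->|]; first by rewrite big_geq// subrr.
rewrite ltnS => nM; rewrite big_nat_recr//= -(IH nM) exprS; field.
by rewrite x1'.
Qed.

Lemma sum_expr (R : realType) (n : nat) (x : R) : x != 1 ->
  \sum_(1 <= k < n.+1) x ^+ k = (x - x ^+ n.+1) / (1 - x).
Proof.
move=> x1; have x1' : 1 - x != 0 by rewrite subr_eq0 eq_sym.
elim: n => [|n IH]; first by rewrite big_geq// subrr mul0r.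
by rewrite big_nat_recr//= IH (exprS x n.+1); field.
Qed.

(** Closed form of the two geometric sums, multiplied by [1 - x]. *)
Lemma beta_eqE (R : realType) (N n : nat) (x : R) : 0 < x < 1 ->
  (N%:R * (\sum_(1 <= k < n.+1) x ^+ k)
    + (2 * N)%:R * limn (fun M => \sum_(n.+1 <= k < M) x ^+ k) = 1) <->
  N.+1%:R * x + N%:R * x ^+ n.+1 = 1.
Proof.
move=> x01; rewrite limn_geometric_tail//; case/andP: x01 => x0 x1.
have x1' : 1 - x != 0 by rewrite subr_eq0 gt_eqF.
rewrite sum_expr ?lt_eqF// natrM -natr1.
set X := x ^+ n.+1.
have -> : N%:R * ((x - X) / (1 - x)) + 2 * N%:R * (X / (1 - x)) =
  (N%:R * x + N%:R * X) / (1 - x) by field.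
split=> [/(congr1 (fun z => z * (1 - x)))|e].
  by rewrite divfK// mul1r => e; lra.
by apply: (mulIf x1'); rewrite divfK// mul1r; lra.
Qed.

Lemma expansion_le1_of_le_beta_ (R : realType) (N n : nat) (beta : R) :
  (0 < N)%N -> 0 < beta -> beta <= beta_ R N n ->
  N.+1%:R * beta + N%:R * beta ^+ n.+1 <= 1.
Proof.
move=> N0 b0; rewrite /beta_; case: xgetP => [x _ [/andP[x0 x1] xE] bx|_].
  have x1' := lt_invSn_lt1 x1.
  have /(beta_eqE N n) /iffLR/(_ xE) gx : 0 < x < 1 by rewrite x0.
  rewrite -[leRHS]gx.
  by apply: lerD; rewrite ler_wpM2l ?ler0n// lerXn2r ?nnegrE// ltW.
by rewrite leNgt b0.
Qed.

Lemma le_beta_of_expansion_le1 (R : realType) (N n : nat) (beta : R) :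
  (0 < N)%N -> 0 < beta < 1 / N.+1%:R ->
  N.+1%:R * beta + N%:R * beta ^+ n.+1 <= 1 -> beta <= beta_ R N n.
Proof.
move=> N0 /andP[b0 b1] gb.
pose g (x : R) := N.+1%:R * x + N%:R * x ^+ n.+1.
have [c cI gc] : exists2 c, c \in `[beta, 1 / N.+1%:R] & g c = 1.
  apply: IVT; first exact: ltW.
    apply: continuous_subspaceT => x; apply: cvgD.
      by apply: cvgMr; exact: cvg_id.
    by apply: cvgMr; exact: exprn_continuous.
  rewrite ge_min gb /= le_max; apply/orP; right.
  rewrite /g div1r divff ?pnatr_eq0//.
  by rewrite lerDl mulr_ge0 ?ler0n// exprn_ge0// invr_ge0 ler0n.
move: cI; rewrite in_itv /= => /andP[bc c1].
have c0 : 0 < c := lt_le_trans b0 bc.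
have c1' : c < 1 / N.+1%:R.
  rewrite lt_neqAle c1 andbT; apply/eqP => cE; move: gc; rewrite /g cE.
  have : 0 < N%:R * N.+1%:R^-1 ^+ n.+1 :> R.
    by rewrite mulr_gt0 ?ltr0n// exprn_gt0// invr_gt0 ltr0Sn.
  by rewrite div1r divff ?pnatr_eq0// => p e; lra.
rewrite /beta_; case: xgetP => [x _ [/andP[x0 x1] xE]|/(_ c)[]]; last first.
  by split; rewrite ?c0 ?c1'//; apply/beta_eqE => //;
    rewrite c0 (lt_invSn_lt1 c1').
rewrite leNgt; apply/negP => xb; move: gb; apply/negP; rewrite -ltNge.
have /(beta_eqE N n) /iffLR/(_ xE) gx : 0 < x < 1.
  by rewrite x0 (lt_invSn_lt1 x1).
rewrite -[ltLHS]gx.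
by apply: ltrD; rewrite ltr_pM2l ?ltr0n// ltrXn2r// ?nnegrE ltW.
Qed.

(** Outside [B_set] the integer [vartheta] is attained: since
    [(N + 1) beta < 1], the inequality [(N + 1) beta + N beta ^ n <= 1] holds
    for large [n]. *)
Lemma varthetaP (R : realType) (N : nat) (beta : R) :
  (0 < N)%N -> 0 < beta < 1 / N.+1%:R ->
  B_set N beta \/
  N.+1%:R * beta + N%:R * beta ^+ (vartheta N beta).+1 <= 1.
Proof.
move=> N0 bnd; case: (pselect (B_set N beta)) => [|nB]; [by left | right].
have [b0 b1] := andP bnd.
rewrite /vartheta asboolF//.
suff /leastP[_ /expansion_le1_of_le_beta_-> //] :
  exists n, (0 < n)%N /\ beta <= beta_ R N n by [].
have d0 : 0 < (1 - N.+1%:R * beta) / N%:R.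
  by rewrite divr_gt0 ?ltr0n// subr_gt0 mulrC -ltr_pdivlMr ?ltr0Sn.
have : (fun n => beta ^+ n : R) @ \oo --> (0 : R).
  by apply: cvg_expr; rewrite ger0_norm ?(lt_invSn_lt1 b1)// ltW.
move=> /cvgr0_norm_lt/(_ _ d0)[n _ /(_ n.+2)] /=.
rewrite ger0_norm ?exprn_ge0 ?ltW// => /(_ (ltnW (leqnSn _))) h.
exists n.+1; split => //; apply: le_beta_of_expansion_le1 => //.
move: h; rewrite ltr_pdivlMr ?ltr0n// => /ltW h; lra.
Qed.

(** * Cancelling the first letter *)

(** The factor [beta] on the left makes the exponents start at 1, as they do
    in [B_set]. *)
Lemma phiw_digits (R : realType) (N n : nat) (beta : R) (w : word N) :
  size w = n ->
  beta * phiw beta w 0 =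
  (1 - beta) / N%:R * \sum_(k < n) (nth ord0 w k : nat)%:R * beta ^+ k.+1.
Proof.
move=> <-; elim: w => [|i w IH] /=; first by rewrite big_ord0 !mulr0.
rewrite big_ord_recl /= /phi IH expr1 mulrDr [RHS]mulrDr addrC; congr (_ + _).
  by ring.
rewrite mulrCA; congr (_ * _); rewrite mulr_sumr; apply: eq_bigr => k _.
by rewrite add0n /bump leq0n add1n [in RHS]exprS mulrCA.
Qed.

(** In base [beta] the hypothesis reads [w + c = v], with [c] aligned to the
    last places.  By uniqueness the digits add up without carry, and [c] has
    digit 0 at the first place because it is shorter than [i :: w]. *)
Lemma head_eq_of_B_set (R : realType) (N : nat) (beta : R) (c w v : word N)
    (i k : 'I_N.+1) :
  (0 < N)%N -> B_set N beta -> size w = size v -> (size c <= size w)%N ->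
  phiw beta (i :: w) (beta ^- size c * phiw beta c 0) = phiw beta (k :: v) 0 ->
  i = k.
Proof.
move=> N0 [/andP[b0 b1] uniq_digits] wv cw.
have N0' : N%:R != 0 :> R by rewrite pnatr_eq0 -lt0n.
(* [c] padded with leading zeros to the common length [n] *)
pose n := (size w).+1; pose c' := nseq (n - size c) ord0 ++ c.
have sc' : size c' = n by rewrite size_cat size_nseq subnK// leqW.
have -> : phiw beta (i :: w) (beta ^- size c * phiw beta c 0) =
    phiw beta (i :: w) 0 + phiw beta c' 0.
  rewrite phiwE; congr (_ + _); rewrite /c' /phiw foldr_cat -!/(phiw _ _ _).
  rewrite phiw_zeros mulrA; congr (_ * _) => /=.
  by rewrite -[in LHS](subnK (leqW cw)) exprD mulfK// expf_neq0// gt_eqF.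
move=> /(congr1 ( *%R beta)); rewrite mulrDr.
rewrite (phiw_digits (n := n) _ (w := i :: w))// (phiw_digits _ sc').
rewrite (phiw_digits (n := n) _ (w := k :: v)); last by rewrite /= -wv.
rewrite -mulrDr -big_split => /mulfI e.
have g0 : (1 - beta) / N%:R != 0.
  by rewrite mulf_neq0 ?invr_eq0// subr_eq0 gt_eqF// (lt_invSn_lt1 b1).
have {e} := e g0.
pose a (l : 'I_n) : 'I_(2 * N).+1 :=
  inord (nth ord0 (i :: w) l + nth ord0 c' l).
have aE l : a l = (nth ord0 (i :: w) l + nth ord0 c' l)%N :> nat.
  by rewrite inordK// ltnS mul2n -addnn leq_add// -ltnS.
pose b (l : 'I_n) : 'I_N.+1 := nth ord0 (k :: v) l.
move=> e; have : a ord0 = b ord0 :> nat.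
  apply: uniq_digits => //; rewrite -e; apply: eq_bigr => l _.
  by rewrite aE natrD mulrDl.
rewrite aE /b /= /c' nth_cat size_nseq subn_gt0 ltnS cw.
by rewrite nth_nseq if_same addn0 => ik; exact: val_inj.
Qed.

(** The image of the unit interval under [phiw beta w] has length
    [beta ^ size w], starts at [phiw beta w 0] and ends at most at 1. *)
Lemma phiw0_le (R : realType) (N : nat) (beta : R) (w : word N) :
  (0 < N)%N -> 0 <= beta <= 1 -> phiw beta w 0 <= 1 - beta ^+ size w.
Proof.
move=> N0 b01; rewrite lerBrDr -[X in _ + X]mulr1 -phiwE.
have u01 : 0 <= (1 : R) <= 1 by rewrite ler01 lexx.
by have /andP[] := phiw_itv w N0 b01 u01.
Qed.

(** The translation is at most [beta ^ vartheta] at the scale of [w], so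
    outside [B_set] the translated point stays below [1 + beta ^ vartheta]; by
    [varthetaP] its image under one more contraction does not reach the next
    first-level piece, and [phi_separated] applies. *)
Lemma head_cancel (R : realType) (N : nat) (beta : R) (c w v : word N)
    (i k : 'I_N.+1) :
  (0 < N)%N -> 0 < beta < 1 / N.+1%:R -> size w = size v ->
  (size c + vartheta N beta <= size w)%N ->
  phiw beta (i :: w) (beta ^- size c * phiw beta c 0) = phiw beta (k :: v) 0 ->
  i = k /\ phiw beta w (beta ^- size c * phiw beta c 0) = phiw beta v 0.
Proof.
move=> N0 bnd wv cw e; have [b0 b1] := andP bnd; have b01 := ratio_itv bnd.
have N0' : 0 < N%:R :> R by rewrite ltr0n.
case: (varthetaP N0 bnd) => [BN|gb].
  have ik := head_eq_of_B_set N0 BN wv (leq_trans (leq_addr _ _) cw) e.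
  split => //; move: e; rewrite ik /= /phi => /addIr/mulfI; apply.
  exact: lt0r_neq0.
have u01 : 0 <= (0 : R) <= 1 by rewrite lexx ler01.
have /andP[v0 v1] := phiw_itv v N0 b01 u01.
have /andP[w0 w1] := phiw_itv w N0 b01 u01.
have /andP[c0 c1] := phiw_itv c N0 b01 u01.
move: e; rewrite [phiw _ (i :: w) _]/= [phiw _ (k :: v) _]/=.
apply: phi_separated => //.
- rewrite phiwE; apply: addr_ge0 => //; apply: mulr_ge0.
    by rewrite exprn_ge0 ?ltW.
  by rewrite mulr_ge0// invr_ge0 exprn_ge0 ?ltW.
- have sE : beta ^+ size w * (beta ^- size c * phiw beta c 0) =
      beta ^+ (size w - size c) * phiw beta c 0.
    rewrite mulrA -[in LHS](subnK (leq_trans (leq_addr _ _) cw)) exprD mulfK//.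
    by rewrite expf_neq0// gt_eqF.
  have le_tail : beta ^+ (size w - size c) * phiw beta c 0 <=
      beta ^+ vartheta N beta.
    apply: (@le_trans _ _ (beta ^+ (size w - size c))).
      by rewrite ger_pMr// exprn_gt0.
    rewrite ler_wiXn2l//; [exact: ltW | by case/andP: b01 |].
    by rewrite leq_subRL// (leq_trans (leq_addr _ _) cw).
  have wlt : phiw beta w 0 < 1.
    apply: le_lt_trans (phiw0_le w N0 b01) _.
    by rewrite ltrBlDr ltrDl exprn_gt0.
  rewrite phiwE sE ltr_pdivlMr//.
  have : phiw beta w 0 + beta ^+ (size w - size c) * phiw beta c 0 <
     1 + beta ^+ vartheta N beta by exact: ltr_leD.
  rewrite -(ltr_pM2l (mulr_gt0 b0 N0')) => h.
  rewrite mulrAC; apply: lt_le_trans h _.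
  (* what remains is [beta * N * (1 + X) <= 1 - beta], the inequality [gb] *)
  move: gb; rewrite exprS -natr1; move: (beta ^+ vartheta N beta) => X.
  by clear; lra.
- by apply: le_lt_trans (beta_lt_gap N0 b1); rewrite ger_pMr.
Qed.

(** * The sets W_t at consecutive levels *)

Lemma A_t_cons (R : realType) (N : nat) (beta : R) (m : nat)
    (s : 'I_m.+1 -> R) (n : nat) (i : 'I_N.+1) (v : word N) :
  A_t beta s n v -> A_t beta s n.+1 (i :: v).
Proof.
move=> [nv [w [nw wE] [j _ jE]]]; split; first by rewrite /words /= nv.
exists (i :: w); last by exists j; rewrite //= jE.
split=> [|l l0]; first by rewrite /words /= nw.
by have [u nu uE] := wE l l0; exists (i :: u); rewrite /words /= ?nu ?uE.
Qed.

(** Stated for an arbitrary translation vector whose components allow the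
    first letter to be cancelled, so that it serves [t] and [- t] alike:
    [Ahat_t] is [A_t] of the opposite vector. *)
Lemma A_t_behead (R : realType) (N : nat) (beta : R) (m : nat)
    (s : 'I_m.+1 -> R) (n : nat) (k : 'I_N.+1) (v : word N) :
  (forall (i k' : 'I_N.+1) (w u : word N) j, size w = n -> size u = n ->
     phiw beta (i :: w) (s j) = phiw beta (k' :: u) 0 ->
     phiw beta w (s j) = phiw beta u 0) ->
  A_t beta s n.+1 (k :: v) -> A_t beta s n v.
Proof.
move=> cancel [[nv] [w [nw wE] [j _ jE]]]; split => //.
case: w nw wE jE => // i w [nw] wE jE.
exists w; last by exists j => //; exact: cancel jE.
split=> // l l0; have [[//|k' u] [nu] uE] := wE l l0.
by exists u => //; apply/esym; apply: cancel (esym uE).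
Qed.

(** Reduces the words translated by [- t j] to [head_cancel], with the two words
    exchanged. *)
Lemma phiw_opp_swap (R : realType) (N : nat) (beta x : R) (w v : word N) :
  size w = size v -> phiw beta w (- x) = phiw beta v 0 ->
  phiw beta v x = phiw beta w 0.
Proof.
move=> wv; rewrite (phiwE beta w (- x)) (phiwE beta v x) => <-.
by rewrite wv; ring.
Qed.

Lemma T_mono (R : realType) (N n k : nat) (beta x : R) : beta != 0 ->
  (n <= k)%N -> T_ N beta n x -> T_ N beta k x.
Proof.
move=> b0 nk [_ [w nw <-] <-]; exists (phiw beta (nseq (k - n) ord0 ++ w) 0).
  exists (nseq (k - n) ord0 ++ w) => //.
  by rewrite /words /= size_cat size_nseq nw subnK.
rewrite /phiw foldr_cat -!/(phiw _ _ _) phiw_zeros mulrA; congr (_ * _).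
by rewrite -{1}(subnK nk) exprD invfM mulrAC mulVf ?mul1r// expf_neq0.
Qed.

Lemma tauP (R : realType) (N : nat) (beta : R) (m : nat) (t : 'I_m.+1 -> R) :
  beta != 0 -> (forall j, T N beta (t j)) ->
  (0 < tau N beta t)%N /\
  forall j : 'I_m.+1, (0 < j)%N -> T_ N beta (tau N beta t) (t j).
Proof.
move=> b0 tT; apply: (@leastP [set n | (0 < n)%N /\
  forall j : 'I_m.+1, (0 < j)%N -> T_ N beta n (t j)]).
have /boolp.choice[f fP] : forall j, exists n, T_ N beta n (t j).
  by move=> j; have [n _ nj] := tT j; exists n.
exists (\max_j f j).+1; split => // j _; apply: T_mono (fP j) => //.
by apply: leqW; exact: leq_bigmax.
Qed.

(** Here the component [t ord0 = 0] gets a code of the same length as the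
    others, the word of zeros. *)
Lemma tau_code_exists (R : realType) (N : nat) (beta : R) (m : nat)
    (t : 'I_m.+1 -> R) : beta != 0 ->
  (forall j, T N beta (t j)) -> t ord0 = 0 -> forall j,
  exists2 c : word N, size c = tau N beta t &
    t j = beta ^- size c * phiw beta c 0.
Proof.
move=> b0 tT t0 j; have [_ tau_code] := tauP b0 tT.
have [/tau_code[_ [c nc <-] <-]|] := ltnP 0 j; first by exists c; rewrite ?nc.
rewrite leqn0 => /eqP j0; exists (nseq (tau N beta t) ord0).
  by rewrite size_nseq.
by rewrite phiw_zeros !mulr0 -t0; congr t; exact: val_inj.
Qed.

Lemma W_t_cat (R : realType) (N : nat) (beta : R) (m : nat)
    (t : 'I_m.+1 -> R) (n : nat) (u v : word N) :
  W_t beta t n v -> W_t beta t (size u + n) (u ++ v).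
Proof.
by move=> Wv; elim: u => //= i u [?|?]; [left | right]; exact: A_t_cons.
Qed.

(** This is where the level has to be at least [tau + vartheta]. *)
Lemma W_t_behead (R : realType) (N : nat) (beta : R) (m : nat)
    (t : 'I_m.+1 -> R) (n : nat) (k : 'I_N.+1) (v : word N) :
  (0 < N)%N -> 0 < beta < 1 / N.+1%:R ->
  (forall j, T N beta (t j)) -> t ord0 = 0 ->
  (tau N beta t + vartheta N beta <= n)%N ->
  W_t beta t n.+1 (k :: v) -> W_t beta t n v.
Proof.
move=> N0 bnd tT t0 n0n.
have b0 : beta != 0 by case/andP: bnd => /lt0r_neq0.
have cancel (i k' : 'I_N.+1) (w u : word N) j : size w = n -> size u = n ->
     phiw beta (i :: w) (t j) = phiw beta (k' :: u) 0 ->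
     phiw beta w (t j) = phiw beta u 0.
  move=> nw nu; have [c sc ->] := tau_code_exists b0 tT t0 j.
  by move=> /head_cancel[]//; rewrite ?nw ?nu// sc.
case=> W; [left|right]; apply: A_t_behead W => // i k' w u j nw nu e.
have e' : phiw beta (k' :: u) (t j) = phiw beta (i :: w) 0.
  by apply: phiw_opp_swap e; rewrite /= nw nu.
have h := cancel _ _ _ _ _ nu nw e'; rewrite -[t j]opprK in h.
by apply: phiw_opp_swap h; rewrite nu nw.
Qed.

Lemma W_t_drop (R : realType) (N : nat) (beta : R) (m : nat)
    (t : 'I_m.+1 -> R) (n l : nat) (v : word N) :
  (0 < N)%N -> 0 < beta < 1 / N.+1%:R ->
  (forall j, T N beta (t j)) -> t ord0 = 0 ->
  (tau N beta t + vartheta N beta <= n)%N ->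
  W_t beta t (l + n) v -> W_t beta t n (drop l v).
Proof.
move=> N0 bnd tT t0 n0n; elim: l v => [|l IH] v; first by rewrite drop0.
case: v => [[[]|[]]//|k v] /W_t_behead-/(_ N0 bnd tT t0) W.
by apply: IH; apply: W; rewrite (leq_trans n0n) ?leq_addl.
Qed.

(** Both sides contract by [beta ^ n]; it suffices that the left endpoints
    agree. *)
Lemma Omega_t_cylinder (R : realType) (N : nat) (beta : R) (m : nat)
    (s : 'I_m.+1 -> R) (n : nat) (w : word N) j :
  s ord0 = 0 -> Omega_t beta s n w ->
  exists2 v : word N, A_t beta s n v &
    forall x, phiw beta w (x + s j) = phiw beta v x.
Proof.
move=> s0 Ow; have [nw wE] := Ow.
have [v nv vE] : E_ N beta n (phiw beta w (s j)).
  have [/wE//|] := ltnP 0 j; rewrite leqn0 => /eqP j0.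
  by rewrite (_ : j = ord0) ?s0; [exists w | exact: val_inj].
exists v; first by split => //; exists w => //; exists j.
by move=> x; rewrite addrC phiwD -vE nw -nv -phiwE.
Qed.

Lemma A_t_cylinder (R : realType) (N : nat) (beta : R) (m : nat)
    (s : 'I_m.+1 -> R) (n : nat) (v : word N) :
  A_t beta s n v ->
  exists2 w : word N, Omega_t beta s n w & exists j, forall x,
    phiw beta v x = phiw beta w (x + s j).
Proof.
move=> [nv [w Ow [j _ jE]]]; exists w => //; exists j => x.
by have [nw _] := Ow; rewrite [LHS]phiwE -jE [x + _]addrC phiwD nv nw.
Qed.

(** * Cycles and windows of words *)

Definition overlap (A : eqType) (n : nat) : rel (seq A) :=
  fun u v => behead u == take n.-1 v.

(** Consecutive vertices of a path share all but one letter, so the path spells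
    a single long word whose windows are its vertices. *)
Lemma overlap_path_unfold (A : eqType) (n : nat) (x : seq A) (p : seq (seq A)) :
  (0 < n)%N -> (forall y, y \in x :: p -> size y = n) -> path (overlap n) x p ->
  exists2 s, size s = (n + size p)%N &
    forall k, (k <= size p)%N -> take n (drop k s) = nth x (x :: p) k.
Proof.
move=> n0; elim: p x => [|y p IH] x sz /=.
  move=> _; exists x; first by rewrite addn0 sz ?mem_head.
  move=> k; rewrite leqn0 => /eqP ->; rewrite drop0 take_oversize//.
  by rewrite sz ?mem_head.
move=> /andP[xy yp]; have [|s ss sP] := IH y _ yp.
  by move=> z zp; apply: sz; rewrite inE zp orbT.
have := sz x (mem_head _ _); case: x xy sz => [|a x] xy sz sx.
  by rewrite -sx in n0.
exists (a :: s) => [|[|k]] /=; first by rewrite ss addnS.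
  move=> _; move/eqP: xy => /= ->; have := sP 0%N (leq0n _).
  rewrite drop0 /= => <-; rewrite take_takel ?leq_pred//.
  by case: (n) n0.
by rewrite ltnS => kp; rewrite sP//; apply: set_nth_default.
Qed.

Lemma cycle_repeat (U : eqType) (e : rel U) (x : U) (p : seq U) (k : nat) :
  path e x p -> last x p = x -> path e x (flatten (nseq k p)).
Proof.
by move=> xp lp; elim: k => //= k IH; rewrite cat_path xp lp.
Qed.

Lemma path_map_iota (U : eqType) (e : rel U) (f : nat -> U) (i l : nat) :
  (forall k, (i <= k < i + l)%N -> e (f k) (f k.+1)) ->
  path e (f i) [seq f k | k <- iota i.+1 l].
Proof.
elim: l i => //= l IH i fe; rewrite fe ?leqnn -?addSnnS ?leq_addr//=.
by apply: IH => k /andP[ik kl]; rewrite fe// (ltnW ik) -addSnnS.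
Qed.

Lemma overlap_windows (A : eqType) (n k : nat) (s : seq A) : (0 < n)%N ->
  overlap n (take n (drop k s)) (take n (drop k.+1 s)).
Proof.
case: n => // n _; rewrite /overlap -pred_Sn take_takel// -[k.+1]add1n.
rewrite -drop_drop drop1.
by case: (drop k s).
Qed.

(** Among the [#|A| ^ n + 1] windows of length [n] two coincide, and the windows
    between them form a cycle. *)
Lemma cycle_of_windows (A : finType) (n : nat) (V : set (seq A)) (s : seq A) :
  (0 < n)%N -> size s = (n + #|A| ^ n)%N ->
  (forall k, (k <= #|A| ^ n)%N -> V (take n (drop k s))) ->
  has_cycle (Digraph V (overlap n)).
Proof.
move=> n0 ss sV; pose win k := take n (drop k s).
have sz (k : 'I_(#|A| ^ n).+1) : size (win k) == n.
  by rewrite size_takel// size_drop ss -addnBA -1?ltnS// leq_addr.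
pose f k : n.-tuple A := Tuple (sz k).
have /injectivePn[i0 [j0 ij0 fij0]] : ~~ injectiveb f.
  apply/negP => /injectiveP/leq_card; rewrite card_ord card_tuple.
  by rewrite ltnn.
have [i [j [ij jK fij]]] :
    exists i j, [/\ (i < j)%N, (j <= #|A| ^ n)%N & win i = win j].
  have e : win i0 = win j0 by exact: (congr1 val fij0).
  move: ij0; rewrite neq_ltn => /orP[] lt.
    by exists i0, j0; split => //; rewrite -ltnS.
  by exists j0, i0; split => //; rewrite -ltnS.
exists (win i), [seq win k | k <- iota i.+1 (j - i)]; split.
- by rewrite -size_eq0 size_map size_iota subn_eq0 -ltnNge.
- move=> y /=; rewrite -[_ :: _]/[seq win k | k <- iota i (j - i).+1].
  move=> /mapP[k]; rewrite mem_iota => /andP[ik kj] ->; apply: sV.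
  by apply: leq_trans jK; move: kj; rewrite addnS subnKC ?ltnS// ltnW.
- by apply: path_map_iota => k _; exact: overlap_windows.
- rewrite last_map fij; congr win.
  by rewrite -nth_last size_iota nth_iota; lia.
Qed.

(** * Admissibility and acyclicity *)

Lemma finite_words (N L : nat) : finite_set [set w : word N | (size w <= L)%N].
Proof.
apply: (@sub_finite_set _ _
  (\bigcup_(n in `I_L.+1) [set val w | w in [set: n.-tuple 'I_N.+1]])).
  by move=> w /= wL; exists (size w); rewrite //=; exists (in_tuple w).
by apply: bigcup_finite => // n _; apply: finite_image; exact: finite_finset.
Qed.

(** Both families may be taken to contain every allowed word up to the length
    at which a window in [W_t] is forced: that is still a finite number of
    words, and the other inclusion holds for any family. *)
Lemma admissible_of_acyclic (R : realType) (N : nat) (beta : R) (m : nat)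
    (Gamma : set R) (t : 'I_m.+1 -> R) :
  (0 < N)%N -> 0 < beta < 1 / N.+1%:R -> is_attractor N beta Gamma ->
  (forall j, T N beta (t j)) -> increasing_from0 t ->
  ~ has_cycle (graph_t N beta t) -> admissible N beta Gamma t.
Proof.
move=> N0 bnd GP tT t_incr acyclic; have [t0 _] := t_incr.
have [b0 b1] := andP bnd.
have b01 : 0 <= beta < 1 by rewrite ltW//= (lt_invSn_lt1 b1).
have [tau0 _] := tauP (lt0r_neq0 b0) tT.
set n0 := (tau N beta t + vartheta N beta)%N in acyclic.
have n0_gt0 : (0 < n0)%N by rewrite addn_gt0 tau0.
pose K := (#|'I_N.+1| ^ n0)%N.
have has_window (u : word N) : size u = (n0 + K)%N ->
    exists2 k, (k <= K)%N & W_t beta t n0 (take n0 (drop k u)).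
  move=> su; apply: contra_notP acyclic => noW.
  apply: (@cycle_of_windows _ n0 _ u) => // k kK; split.
    rewrite /words /= size_takel// size_drop su leq_subRL; last first.
      by rewrite (leq_trans kK) ?leq_addl.
    by rewrite addnC leq_add2l.
  by move=> Wk; apply: noW; exists k.
pose I (s : 'I_m.+1 -> R) := [set w : word N | (size w <= n0 + K)%N /\
  exists2 n, (tau N beta t <= n)%N & Omega_t beta s n w].
have fin_I s : finite_set (I s).
  by apply: sub_finite_set (finite_words N (n0 + K)) => w [].
split => //; exists (I t), (I (fun j => - t j)); split => //.
- by move=> w [_ [n tn Ow]]; exists n.
- by move=> w [_ [n tn Ow]]; exists n.
apply/seteqP; split => [x [[w [_ [n _ Ow]]]|[w [_ [n _ Ow]]]]|x Gx].
- move=> [_ [j _ [y Gy <-]] <-].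
  by have [v _ ->] := Omega_t_cylinder j t0 Ow; exact: attractor_phiw.
- move=> [_ [_ [j _ [y Gy <-]] <-] <-].
  have [|v _ vE] := Omega_t_cylinder j _ Ow; first by rewrite t0 oppr0.
  rewrite opprD addrA vE; apply: attractor_phiw => //.
  exact: attractor_sym N0 b01 GP _ Gy.
have [u su [y Gy xE]] := attractor_code (n0 + K) GP Gx.
(* the prefix [v] of [u] ending with a window in [W_t] is itself in [W_t] *)
have [k kK Wk] := has_window u su.
pose v := take (k + n0) u.
have Wv : W_t beta t (k + n0) v.
  have -> : v = take k u ++ take n0 (drop k u) by rewrite -takeD.
  have {1}<- : size (take k u) = k.
    by rewrite size_takel// su (leq_trans kK) ?leq_addl.
  exact: W_t_cat.
have sv : size v = (k + n0)%N.
  by rewrite size_takel// su addnC leq_add2l.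
pose y' := phiw beta (drop (k + n0) u) y.
have Gy' : Gamma y' by exact: attractor_phiw.
have {}xE : x = phiw beta v y'.
  by rewrite xE -[in LHS](cat_take_drop (k + n0) u) /phiw foldr_cat.
have tn : (tau N beta t <= k + n0)%N by rewrite addnCA leq_addr.
have sw w s : Omega_t beta s (k + n0) w -> I s w.
  move=> Ow; split; last by exists (k + n0)%N.
  by have [-> _] := Ow; rewrite addnC leq_add2l.
case: Wv => /A_t_cylinder[w Ow [j wE]]; [left | right];
  exists w; rewrite ?xE ?wE; do ?exact: sw.
- by exists (y' + t j) => //; exists j => //; exists y'.
- exists (y' - t j) => //; exists (1 - y' + t j); last by ring.
  exists j => //; exists (1 - y') => //; exact: attractor_sym N0 b01 GP _ Gy'.
Qed.

Lemma acyclic_of_admissible (R : realType) (N : nat) (beta : R) (m : nat)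
    (Gamma : set R) (t : 'I_m.+1 -> R) :
  (0 < N)%N -> 0 < beta < 1 / N.+1%:R -> is_attractor N beta Gamma ->
  (forall j, T N beta (t j)) -> increasing_from0 t ->
  admissible N beta Gamma t -> ~ has_cycle (graph_t N beta t).
Proof.
move=> N0 bnd GP tT [t0 _] [_ _ [I1 [I2 [fI1 fI2 sI1 sI2 cover]]]].
have [b0 b1] := andP bnd.
have b01 : 0 <= beta < 1 by rewrite ltW//= (lt_invSn_lt1 b1).
have [tau0 _] := tauP (lt0r_neq0 b0) tT.
move=> [x [p [pN0 pV xp lxp]]].
set n0 := (tau N beta t + vartheta N beta)%N in pV xp.
have n0_gt0 : (0 < n0)%N by rewrite addn_gt0 tau0.
have [K IK] : exists K, forall w, (I1 `|` I2) w -> (size w <= K)%N.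
  have /finite_seqP[ws wsE] : finite_set (I1 `|` I2) by rewrite finite_setU.
  exists (\max_(w <- ws) size w)%N => w; rewrite wsE /= => wws.
  exact: (leq_bigmax_seq _ wws).
(* [K] turns around the cycle *)
pose q := flatten (nseq K p).
have Kq : (K <= size q)%N.
  rewrite size_flatten /shape map_nseq sumn_nseq leq_pmull//.
  by rewrite lt0n size_eq0.
have qV y : y \in x :: q -> vertices (graph_t N beta t) y.
  rewrite inE => /orP[/eqP->|/flattenP[p']].
    by apply: pV; exact: mem_head.
  by rewrite mem_nseq => /andP[_ /eqP->] yp; apply: pV; rewrite inE yp orbT.
have qsz y : y \in x :: q -> size y = n0 by move=> /qV[].
have [s ss sP] := overlap_path_unfold n0_gt0 qsz (cycle_repeat K xp lxp).
have [[y Gy] _ _] := GP.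
pose u := drop n0 s.
have su : size u = size q by rewrite size_drop ss addKn.
have G01 := attractor_itv N0 b01 GP.
have absurd n (v : word N) z : (n <= K)%N -> W_t beta t n v -> Gamma z ->
    phiw beta v z = phiw beta u y -> False.
  move=> nK Wv Gz vu; have sv : size v = n by case: Wv => -[].
  have nq := leq_trans nK Kq.
  have vE : v = take n u.
    rewrite -sv; apply: (overlapping_cylinders_nested (x := y) (y := z)
      (beta := beta)) => //.
    - by rewrite sv su.
    - exact: G01.
    - exact: G01.
  (* The [n0] letters of [s] before [u] complete [v] to a word of level at
     least [n0], even if [v] itself is shorter. *)
  have st : size (take n0 s) = n0 by rewrite size_takel// ss leq_addr.
  have := W_t_cat (take n0 s) Wv; rewrite st addnC vE -takeD => W.
  have := W_t_drop N0 bnd tT t0 (leqnn n0) W; rewrite -take_drop sP//.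
  by have [_] := qV _ (mem_nth x (nq : (n < size (x :: q))%N)).
have : Gamma (phiw beta u y) by exact: attractor_phiw.
rewrite -cover => -[[w Iw]|[w Iw]].
- have [n _ Ow] := sI1 _ Iw; move=> [_ [j _ [z Gz <-]]].
  have [v Av ->] := Omega_t_cylinder j t0 Ow.
  apply: (absurd n) => //; last by left.
  by have [<- _] := Ow; apply: IK; left.
- have [n _ Ow] := sI2 _ Iw; move=> [_ [_ [j _ [z Gz <-]] <-]].
  have [|v Av vE] := Omega_t_cylinder j _ Ow; first by rewrite t0 oppr0.
  rewrite opprD addrA vE; apply: (absurd n) => //.
  + by have [<- _] := Ow; apply: IK; right.
  + by right.
  + exact: attractor_sym N0 b01 GP _ Gz.
Qed.

Theorem theorem1p4 (R : realType) (N : nat) (beta : R) (m : nat)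
    (Gamma : set R) (t : 'I_m.+1 -> R)
    (N_gt0 : (0 < N)%N) (beta_bnd : 0 < beta < 1 / N.+1%:R) (m_gt0 : (0 < m)%N)
    (GammaP : is_attractor N beta Gamma)
    (tT : forall j, T N beta (t j)) (t_incr : increasing_from0 t) :
  admissible N beta Gamma t <-> ~ has_cycle (graph_t N beta t).
Proof.
split; first exact: acyclic_of_admissible.
exact: admissible_of_acyclic.
Qed.
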